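(* Let $M$ be a smooth manifold and $X\in\mathcal{X}(M)$ a smooth vector field. Then for every $p$ the map $$\widetilde{H}^{p}_X(M)\to H^{p}_{dR}(M)\oplus H^{p-1}_{dR}(M),\qquad [(\varphi,\psi)]\mapsto ([\varphi],[\imath_X\varphi-\psi])$$ is well defined and is an isomorphism of real vector spaces, with inverse $$H^{p}_{dR}(M)\oplus H^{p-1}_{dR}(M)\to \widetilde{H}^{p}_X(M),\qquad ([\varphi],[\psi])\mapsto[(\varphi,\imath_X\varphi-\psi)].$$ In particular $\widetilde{H}^{\bullet}_X(M)\cong H^{\bullet}_{dR}(M)\oplus H^{\bullet-1}_{dR}(M)$.
   Context: $\Omega^p(M)$ is the space of smooth real $p$-forms on $M$ (zero for $p<0$), $\imath_X$ is interior product, $\mathcal{L}_X$ the Lie derivative, $H^\bullet_{dR}(M)$ the de Rham cohomology. Put $\widetilde{\Omega}^p(M)=\Omega^p(M)\oplus\Omega^{p-1}(M)$ and define $\widetilde{d}_X:\widetilde{\Omega}^p(M)\to\widetilde{\Omega}^{p+1}(M)$ by $\widetilde{d}_X(\varphi,\psi)=(d\varphi,\mathcal{L}_X\varphi-d\psi)$. One has $\widetilde{d}_X^2=0$, and $\widetilde{H}^\bullet_X(M)$ denotes the cohomology of the complex $(\widetilde{\Omega}^\bullet(M),\widetilde{d}_X)$. *)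

(* Defs.v *)
From HB Require Import structures.
From mathcomp Require Import all_boot all_order all_algebra.
From mathcomp Require Import all_classical all_reals all_analysis.

Set Implicit Arguments.
Unset Strict Implicit.
Unset Printing Implicit Defensive.

Import Order.TTheory GRing.Theory Num.Theory numFieldNormedType.Exports.
Local Open Scope classical_set_scope.
Local Open Scope ring_scope.
Local Open Scope quotient_scope.

Section Smooth.
Context {R : realType} {V W : normedModType R}.

(* f is C^oo on the open set U: every iterated directional derivative
   D_{v1} (... (D_{vk} f)), k >= 0, is Frechet differentiable on U (hence
   continuous on U, with all its directional derivatives existing on U). *)
Definition smooth_on (U : set V) (f : V -> W) : Prop :=
  forall vs : seq V, {in U, forall y,
    differentiable (foldr (fun v g => 'D_v g) f vs) y}.

Lemma near_eq_differentiable (f g : V -> W) (x : V) :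
  (\near x, f x = g x) -> differentiable f x -> differentiable g x.
Proof.
move=> fg df; have gx : f x = g x by exact: nbhs_singleton fg.
have shg : g \o shift x = cst (g x) + 'd f x +o_ 0 id.
  apply/eqaddoP => e e0; have /eqaddoP/(_ e e0) := diff_locally df.
  have : \forall y \near (0 : V), f (y + x) = g (y + x).
    by move: fg; rewrite (near_shift 0 x) /= => h; near=> y; rewrite -[X in y + X]subr0; near: y.
  apply: filterS2 => y /= Hy; rewrite !fctE /= /shift Hy gx; exact.
have cf := diff_continuous df.
have E := diff_unique cf shg.
by apply/diff_locallyP; rewrite E.
Unshelve. all: by end_near. Qed.

Lemma smooth_on_eq (U : set V) (f g : V -> W) : open U ->
  {in U, f =1 g} -> smooth_on U f -> smooth_on U g.
Proof.
move=> oU fg sf vs.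
have near_U (h k : V -> W) y : y \in U -> {in U, h =1 k} ->
    \near y, h y = k y.
  rewrite inE => Uy hk; have : nbhs y U by exact: open_nbhs_nbhs.
  by apply: filterS => z Uz; apply: hk; rewrite inE.
have H : {in U, foldr (fun v h => 'D_v h) f vs =1 foldr (fun v h => 'D_v h) g vs}.
  elim: vs => [//|v vs IH] y Uy /=.
  by apply: near_eq_derive; exact: near_U.
by move=> y Uy; apply: near_eq_differentiable (sf vs y Uy); exact: near_U.
Qed.

Lemma smooth_on_lin (U : set V) (a : R) (f g : V -> W) : open U ->
  smooth_on U f -> smooth_on U g -> smooth_on U (a *: f + g).
Proof.
move=> oU sf sg vs.
pose it := foldr (fun v (h : V -> W) => 'D_v h).
have near_U (h k : V -> W) y : y \in U -> {in U, h =1 k} ->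
    \near y, h y = k y.
  rewrite inE => Uy hk; have : nbhs y U by exact: open_nbhs_nbhs.
  by apply: filterS => z Uz; apply: hk; rewrite inE.
have H : {in U, it (a *: f + g) vs =1 a *: it f vs + it g vs}.
  elim: vs => [//|v vs IH] y Uy /=.
  have df := sf vs y Uy; have dg := sg vs y Uy.
  rewrite (near_eq_derive v (near_U _ _ _ Uy IH)) deriveD ?deriveZ //.
  - exact: diff_derivable.
  - by apply: diff_derivable; exact: differentiableZ.
  - exact: diff_derivable.
move=> y Uy; apply: (@near_eq_differentiable (a *: it f vs + it g vs)).
  by apply: near_U => // z Uz; apply/esym; exact: H.
by apply: differentiableD; [apply: differentiableZ; exact: sf|exact: sg].
Qed.

Lemma smooth_on0 (U : set V) : smooth_on U (0 : V -> W).
Proof.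
move=> vs; suff -> : foldr (fun v (h : V -> W) => 'D_v h) 0 vs = 0.
  by move=> y _; exact: differentiable_cst.
by elim: vs => [//|v vs /= ->]; apply/funext => y; exact: derive_cst.
Qed.

End Smooth.

Section Manifold.
Context (R : realType) (n : nat).
Local Notation E := 'rV[R]_n.

(* A homeomorphism [chart_map] from an open set [chart_dom] of T onto an open set of R^n,
   with inverse [chart_inv].  Only the values of [chart_map] on [chart_dom] and of [chart_inv] on
   the image [chart_map @` chart_dom] matter. *)
Record chart (T : topologicalType) := Chart {
  chart_dom : set T;
  chart_map : T -> E;
  chart_inv : E -> T;
  chart_dom_open : open chart_dom;
  chart_image_open : open (chart_map @` chart_dom);
  chart_map_cont : {within chart_dom, continuous chart_map};
  chart_inv_cont : {within chart_map @` chart_dom, continuous chart_inv};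
  chart_mapK : {in chart_dom, cancel chart_map chart_inv} }.

Definition transition (T : topologicalType) (c c' : chart T) : E -> E :=
  chart_map c' \o chart_inv c.

(* Smooth n-dimensional manifolds without boundary; the smooth structure is
   given by an atlas, which need not be maximal. *)
Record manifold := Manifold {
  points :> topologicalType;
  points_hausdorff : hausdorff_space points;
  points_countable : @second_countable points;
  chart_index : Type;
  charts : chart_index -> chart points;
  charts_cover : \bigcup_c chart_dom (charts c) = [set: points];
  charts_smooth : forall c c',
    smooth_on (chart_map (charts c) @` (chart_dom (charts c) `&` chart_dom (charts c')))
              (transition (charts c) (charts c')) }.

End Manifold.

Arguments chart_index {R n} m.
Arguments charts {R n} m _.

Section Fields.
Context (R : realType) (n : nat) (M : manifold R n).
Local Notation E := 'rV[R]_n.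
Local Notation I := (chart_index M).
Local Notation U c := (chart_dom (charts M c)).
Local Notation x_ c := (chart_map (charts M c)).
Local Notation p_ c := (chart_inv (charts M c)).

(* The differential at x of the change of coordinates from c to c'. *)
Definition jac (c c' : I) (x : M) (v : E) : E :=
  'D_v (transition (charts M c) (charts M c')) (x_ c x).

(* A smooth vector field, given by its components in each chart:
   [vcomp c x] lists the coordinates of X_x in the basis (d/dx^i)_i of T_x M
   attached to the chart c. *)
Record vector_field := VectorField {
  vcomp :> I -> M -> E;
  vcomp_compat : forall c c' x, x \in U c -> x \in U c' ->
    vcomp c' x = jac c c' x (vcomp c x);
  vcomp_smooth : forall c, smooth_on (x_ c @` U c) (vcomp c \o p_ c) }.

(* Differential forms are described by their local expressions: for
   s = [:: v1; ...; vp], [w c x s] is the value of w_x on the tangent vectors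
   with coordinates v1, ..., vp in the chart c.  The arguments are a list, so
   that forms of all degrees share one vector space; [is_form p] fixes the degree. *)
Definition preform := I -> M -> seq E -> R.
HB.instance Definition _ := GRing.Lmodule.on preform.

Record is_form (p : int) (w : preform) : Prop := Form {
  (* a p-form takes p arguments (there are none for p < 0), and the local
     expression in c is set to 0 outside of the domain of c *)
  form_supp : forall c x s,
    ~ (x \in U c /\ (size s)%:Z = p) -> w c x s = 0;
  form_linear : forall c x s1 s2 (a : R) (u v : E),
    w c x (s1 ++ (a *: u + v) :: s2)
      = a * w c x (s1 ++ u :: s2) + w c x (s1 ++ v :: s2);
  form_alternating : forall c x s, ~~ uniq s -> w c x s = 0;
  form_compat : forall c c' x s, x \in U c -> x \in U c' ->
    w c x s = w c' x (map (jac c c' x) s);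
  form_smooth : forall c s,
    smooth_on (x_ c @` U c) (fun y => w c (p_ c y) s) }.

(* Derivative at x, in the direction v, of a function read in the chart c. *)
Definition chart_derive (W : normedModType R) (c : I) (f : M -> W) (x : M)
  (v : E) : W := 'D_v (f \o p_ c) (x_ c x).

(* (dw)_x(v_0,...,v_p)
     = \sum_i (-1)^i D_{v_i} (w(v_0,...,^v_i,...,v_p)), v_i constant in c,
   i.e. d(w_J dx^J) = \sum_i (d w_J / d x^i) dx^i /\ dx^J. *)
Definition ext_d (w : preform) : preform := fun c x s =>
  if x \in U c then
    \sum_(i < size s) (-1) ^+ i *
      chart_derive c (fun y => w c y (take i s ++ drop i.+1 s)) x s`_i
  else 0.

Definition interior_product (X : vector_field) (w : preform) : preform :=
  fun c x s => w c x (X c x :: s).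

(* (L_X w)_{i_1...i_p}
     = X^k (d_k w_{i_1...i_p}) + \sum_j (d_{i_j} X^k) w_{i_1...k...i_p}. *)
Definition lie (X : vector_field) (w : preform) : preform := fun c x s =>
  if x \in U c then
    chart_derive c (fun y => w c y s) x (X c x)
    + \sum_(i < size s) w c x (set_nth 0 s i (chart_derive c (X c) x s`_i))
  else 0.

Lemma preformE (a : R) (w1 w2 : preform) c x s :
  (a *: w1 + w2) c x s = a * w1 c x s + w2 c x s.
Proof. by []. Qed.

Lemma form0 p : is_form p 0.
Proof.
split=> //; last by move=> c s; exact: smooth_on0.
by move=> c x s1 s2 a u v; rewrite -[RHS]/(a * 0 + 0) mulr0 addr0.
Qed.

Lemma form_lin p a w1 w2 : is_form p w1 -> is_form p w2 -> is_form p (a *: w1 + w2).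
Proof.
move=> f1 f2; split.
- move=> c x s H; rewrite preformE (form_supp f1 H) (form_supp f2 H).
  by rewrite mulr0 addr0.
- move=> c x s1 s2 b u v; rewrite !preformE (form_linear f1) (form_linear f2).
  by rewrite !mulrDr addrACA mulrCA.
- move=> c x s H; rewrite preformE (form_alternating f1) //.
  by rewrite (form_alternating f2) // mulr0 addr0.
- move=> c c' x s xc xc'; rewrite !preformE.
  by rewrite (form_compat f1 s xc xc') (form_compat f2 s xc xc').
- move=> c s; apply: smooth_on_lin.
  + exact: chart_image_open.
  + exact: (form_smooth f1).
  + exact: (form_smooth f2).
Qed.

Lemma chart_derive_lin p a w1 w2 c x s v : is_form p w1 -> is_form p w2 ->
  x \in U c ->
  chart_derive c (fun y => (a *: w1 + w2) c y s) x v
  = a * chart_derive c (fun y => w1 c y s) x v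
    + chart_derive c (fun y => w2 c y s) x v.
Proof.
move=> f1 f2 xc.
have xU : x_ c x \in x_ c @` U c by rewrite inE; exists x => //; rewrite -inE.
have d1 := form_smooth f1 s [::] xU.
have d2 := form_smooth f2 s [::] xU.
rewrite /chart_derive -[LHS]/('D_v (a *: ((fun y => w1 c y s) \o p_ c)
  + ((fun y => w2 c y s) \o p_ c)) (x_ c x)).
rewrite deriveD ?deriveZ //; do ?exact: diff_derivable.
by apply: diff_derivable; exact: differentiableZ.
Qed.

Lemma ext_d_lin p a w1 w2 : is_form p w1 -> is_form p w2 ->
  ext_d (a *: w1 + w2) = a *: ext_d w1 + ext_d w2.
Proof.
move=> f1 f2; apply/funext => c; apply/funext => x; apply/funext => s.
rewrite preformE /ext_d.
case: ifPn => xc; last by rewrite mulr0 addr0.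
rewrite mulr_sumr -big_split /=; apply: eq_bigr => i _.
by rewrite (chart_derive_lin _ _ _ f1 f2) // mulrDr mulrCA.
Qed.

Lemma lie_lin X p a w1 w2 : is_form p w1 -> is_form p w2 ->
  lie X (a *: w1 + w2) = a *: lie X w1 + lie X w2.
Proof.
move=> f1 f2; apply/funext => c; apply/funext => x; apply/funext => s.
rewrite preformE /lie.
case: ifPn => xc; last by rewrite mulr0 addr0.
rewrite (chart_derive_lin _ _ _ f1 f2) // mulrDr addrACA; congr (_ + _).
by rewrite mulr_sumr -big_split.
Qed.

End Fields.

(* A complex of real vector spaces, presented inside one vector space [ambient]:
   [cochains p] is the subspace of degree p.  That [differential] raises the
   degree by 1 and squares to 0 is not needed to define the cohomology below. *)
Record complex (R : realType) := Complex {
  ambient : lmodType R;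
  cochains : int -> set ambient;
  differential : ambient -> ambient;
  cochains0 : forall p, cochains p 0;
  cochains_lin : forall p (a : R) x y, cochains p x -> cochains p y ->
    cochains p (a *: x + y);
  differential_lin : forall p (a : R) x y, cochains p x -> cochains p y ->
    differential (a *: x + y) = a *: differential x + differential y }.

Section Cohomology.
Context (R : realType) (C : complex R).

Lemma differential0 : differential 0 = 0 :> ambient C.
Proof.
have := differential_lin (-1) (cochains0 C 0) (cochains0 C 0).
by rewrite scaler0 addr0 scaleN1r addNr.
Qed.

Variable p : int.

Definition is_cocycle : {pred ambient C} :=
  [pred x | `[< cochains p x /\ differential x = 0 >]].

Fact is_cocycle_submod : GRing.submod_closed is_cocycle.
Proof.
split=> [|a x y]; rewrite !inE.
  by split; [exact: cochains0|exact: differential0].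
move=> [cx dx] [cy dy]; split.
  exact: cochains_lin.
by rewrite (differential_lin _ cx cy) dx dy scaler0 addr0.
Qed.
HB.instance Definition _ :=
  GRing.isSubmodClosed.Build R (ambient C) is_cocycle is_cocycle_submod.

Record cocycle := Cocycle {
  cocycle_val :> ambient C;
  _ : cocycle_val \in is_cocycle }.
HB.instance Definition _ := [isSub for cocycle_val].
HB.instance Definition _ := [Choice of cocycle by <:].
HB.instance Definition _ := [SubChoice_isSubLmodule of cocycle by <:].

(* Coboundaries are taken among the cocycles, so that the quotient makes sense
   without invoking D^2 = 0; they are all of D(C^(p-1)) when D^2 = 0. *)
Definition is_coboundary : {pred cocycle} :=
  [pred z | `[< exists2 y, cochains (p - 1) y & differential y = val z >]].

Fact is_coboundary_submod : GRing.submod_closed is_coboundary.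
Proof.
split=> [|a x y]; rewrite !inE.
  by exists 0; [exact: cochains0|rewrite differential0].
move=> [x' cx dx] [y' cy dy].
exists (a *: x' + y'); first exact: cochains_lin.
by rewrite (differential_lin _ cx cy) dx dy.
Qed.
HB.instance Definition _ :=
  GRing.isSubmodClosed.Build R cocycle is_coboundary is_coboundary_submod.

Definition cohomology := {ideal_quot is_coboundary}.
HB.instance Definition _ := GRing.Zmodule.on cohomology.

Definition coho_class (z : cocycle) : cohomology := \pi_cohomology z.

Lemma coho_class_repr (h : cohomology) : h = coho_class (repr h).
Proof. by rewrite /coho_class reprK. Qed.

Definition cohomology_scale (a : R) : cohomology -> cohomology :=
  fun h => coho_class (a *: repr h).

Lemma coho_class_eq (x y : cocycle) : (coho_class x == coho_class y) = (x - y \in is_coboundary).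
Proof. by rewrite Quotient.idealrBE. Qed.

Lemma coho_class_scale a (z : cocycle) : cohomology_scale a (coho_class z) = coho_class (a *: z).
Proof.
apply/eqP; rewrite coho_class_eq -scalerBr rpredZ // -coho_class_eq /coho_class.
by rewrite reprK.
Qed.

Lemma coho_classD : {morph coho_class : x y / x + y}.
Proof. by move=> x y; rewrite /coho_class !piE. Qed.

Fact cohomology_scaleA a b h :
  cohomology_scale a (cohomology_scale b h) = cohomology_scale (a * b) h.
Proof. by rewrite [h]coho_class_repr !coho_class_scale scalerA. Qed.
Fact cohomology_scale1 : left_id 1 cohomology_scale.
Proof. by move=> h; rewrite [h]coho_class_repr coho_class_scale scale1r. Qed.
Fact cohomology_scaleDr : right_distributive cohomology_scale +%R.
Proof.
move=> a x y; rewrite [x]coho_class_repr [y]coho_class_repr.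
by rewrite -coho_classD !coho_class_scale -coho_classD scalerDr.
Qed.
Fact cohomology_scaleDl h : {morph cohomology_scale^~ h : a b / a + b}.
Proof. by move=> a b; rewrite [h]coho_class_repr !coho_class_scale -coho_classD scalerDl. Qed.
HB.instance Definition _ := GRing.Zmodule_isLmodule.Build R cohomology
  cohomology_scaleA cohomology_scale1 cohomology_scaleDr cohomology_scaleDl.

Fact coho_class_linear : linear coho_class.
Proof. by move=> a x y; rewrite coho_classD -coho_class_scale. Qed.
HB.instance Definition _ :=
  GRing.isLinear.Build R cocycle cohomology _ coho_class coho_class_linear.

End Cohomology.

Section Complexes.
Context (R : realType) (n : nat) (M : manifold R n).

Definition de_rham : complex R :=
  @Complex R (preform M) (@is_form R n M) (@ext_d R n M)
    (@form0 R n M) (@form_lin R n M) (@ext_d_lin R n M).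

Context (X : vector_field M).

Definition tilde_form (p : int) : set (preform M * preform M) :=
  [set w | is_form p w.1 /\ is_form (p - 1) w.2].

Definition tilde_d (w : preform M * preform M) : preform M * preform M :=
  (ext_d w.1, lie X w.1 - ext_d w.2).

Fact tilde_form0 p : tilde_form p 0.
Proof. by split; exact: form0. Qed.
Fact tilde_form_lin p (a : R) w1 w2 :
  tilde_form p w1 -> tilde_form p w2 -> tilde_form p (a *: w1 + w2).
Proof.
by move=> [f1 g1] [f2 g2]; split; [exact: (form_lin a f1 f2)|
  exact: (form_lin a g1 g2)].
Qed.
Fact tilde_d_lin p (a : R) w1 w2 : tilde_form p w1 -> tilde_form p w2 ->
  tilde_d (a *: w1 + w2) = a *: tilde_d w1 + tilde_d w2.
Proof.
move=> [f1 g1] [f2 g2]; rewrite /tilde_d /= (ext_d_lin a f1 f2).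
rewrite (ext_d_lin a g1 g2) (lie_lin X a f1 f2); congr (_, _) => /=.
by rewrite scalerBr opprD addrACA.
Qed.

Definition tilde_complex : complex R :=
  Complex tilde_form0 tilde_form_lin tilde_d_lin.
End Complexes.

(* Main.v *)
(* By Cartan's formula L_X = d i_X + i_X d, the mutually inverse maps
   (phi, psi) |-> (phi, i_X phi - psi) and (a, b) |-> (a, i_X a - b) exchange
   the cocycles of the two complexes.  On coboundaries,
     (d alpha, L_X alpha - d beta) |-> (d alpha, d (beta - i_X alpha)), and
     (d alpha, d beta) |-> D (alpha, i_X alpha + beta),
   where D is the differential of the tilde complex, so both maps descend to
   cohomology. *)

Require Import Defs.
From HB Require Import structures.
From mathcomp Require Import all_boot all_order all_algebra.
From mathcomp Require Import all_classical all_reals all_analysis.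

Set Implicit Arguments.
Unset Strict Implicit.
Unset Printing Implicit Defensive.

Import Order.TTheory GRing.Theory Num.Theory numFieldNormedType.Exports.
Local Open Scope ring_scope.

(** * Closure of smooth functions under sums, coordinates and products *)

Section Smooth.
Context {R : realType} {V : normedModType R}.
Implicit Types (U : set V) (y v : V).

Lemma near_eq_in (W : Type) U (f g : V -> W) y : open U -> {in U, f =1 g} ->
  y \in U -> \near y, f y = g y.
Proof.
move=> oU fg; rewrite inE => Uy.
by apply: filterS (open_nbhs_nbhs (conj oU Uy)) => z Uz; apply: fg; rewrite inE.
Qed.

Lemma smooth_on_sum (W : normedModType R) U n (f : 'I_n -> V -> W) : open U ->
  (forall i, smooth_on U (f i)) -> smooth_on U (\sum_(i < n) f i).
Proof.
move=> oU sf; elim/big_ind: _ => [|g h sg sh|i _]; last exact: sf.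
  exact: smooth_on0.
by rewrite -[g]scale1r; exact: smooth_on_lin.
Qed.

Lemma derive_coord m k (f : V -> 'M[R]_(m, k)) y v i j : derivable f y v ->
  'D_v (fun z => f z i j) y = ('D_v f y) i j.
Proof. by move=> df; rewrite (derive_mx df) mxE. Qed.

(** Taking an entry commutes with directional derivatives, so on [U] the iterated derivatives of an
    entry are the entries of the iterated derivatives. *)
Lemma smooth_on_coord U m k (f : V -> 'M[R]_(m, k)) i j : open U ->
  smooth_on U f -> smooth_on U (fun y => f y i j).
Proof.
move=> oU sf vs; pose it (W : normedModType R) := foldr (fun v (g : V -> W) => 'D_v g).
have H : {in U, it R (fun y => f y i j) vs =1 fun y => it _ f vs y i j}.
  elim: vs => [//|v vs IH] y Uy /=.
  rewrite (near_eq_derive v (near_eq_in oU IH Uy)) derive_coord //.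
  exact: diff_derivable (sf vs y Uy).
move=> y Uy; apply: (@near_eq_differentiable _ _ _ (fun y => it _ f vs y i j)).
  by apply: (near_eq_in oU) Uy => z Uz; exact/esym/H.
apply: (@differentiable_comp _ _ _ _ (it _ f vs) (fun N => N i j)).
  exact: sf.
exact: differentiable_coord.
Qed.

(* Iterated derivatives of a product are sums of products of iterated
   derivatives of the factors. *)
Lemma smooth_onM U (f g : V -> R) : open U ->
  smooth_on U f -> smooth_on U g -> smooth_on U (f * g).
Proof.
move=> oU sf sg vs.
pose it := foldr (fun v (h : V -> R) => 'D_v h).
pose S (l : seq (seq V * seq V)) := \sum_(q <- l) it f q.1 * it g q.2.
have dS l : {in U, forall y, differentiable (S l) y}.
  move=> y Uy; rewrite /S; elim: l => [|q l IH].
    by rewrite big_nil; exact: differentiable_cst.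
  rewrite big_cons; apply: differentiableD => //.
  by apply: differentiableM; [exact: sf|exact: sg].
have [l H] : exists l, {in U, it (f * g) vs =1 S l}.
  elim: vs => [|v vs [l IH]].
    by exists [:: ([::], [::])] => y _; rewrite /S big_seq1.
  (* Leibniz rule: the new direction [v] falls on either factor, so each term splits in two. *)
  exists (flatten [seq [:: (q.1, v :: q.2); (v :: q.1, q.2)] | q <- l]) => y Uy.
  rewrite /= (near_eq_derive v (near_eq_in oU IH Uy)) {IH}.
  elim: l => [|q l IH] /=.
    by rewrite /S !big_nil; exact: derive_cst.
  have df := sf q.1 y Uy; have dg := sg q.2 y Uy.
  have -> : S (q :: l) = it f q.1 * it g q.2 + S l by rewrite /S big_cons.
  rewrite deriveD; [|by apply: diff_derivable; exact: differentiableM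
    |by apply: diff_derivable; exact: dS].
  rewrite deriveM ?IH; [|exact: diff_derivable..].
  rewrite /S !big_cons /= addrA; congr (_ + _ + _).
  by rewrite mulrC.
move=> y Uy; apply: (@near_eq_differentiable _ _ _ (S l)); last exact: dS.
by apply: (near_eq_in oU) Uy => z Uz; exact/esym/H.
Qed.

End Smooth.

(** * Multilinear alternating functions of a list of vectors *)

Section Multilinear.
Context (R : comPzRingType) (E : lmodType R) (w : seq E -> R).
Context (w_linear : forall s1 s2 a u v,
  w (s1 ++ (a *: u + v) :: s2) = a * w (s1 ++ u :: s2) + w (s1 ++ v :: s2)).

Lemma multilinearD s1 s2 u v :
  w (s1 ++ (u + v) :: s2) = w (s1 ++ u :: s2) + w (s1 ++ v :: s2).
Proof. by rewrite -[u]scale1r w_linear scale1r mul1r. Qed.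

Lemma multilinear0 s1 s2 : w (s1 ++ 0 :: s2) = 0.
Proof.
by have := w_linear s1 s2 (-1) 0 0; rewrite scaler0 addr0 mulN1r addNr.
Qed.

Lemma multilinearZ s1 s2 a u : w (s1 ++ (a *: u) :: s2) = a * w (s1 ++ u :: s2).
Proof. by rewrite -[a *: u]addr0 w_linear multilinear0 addr0. Qed.

Lemma multilinear_sum I (r : seq I) s1 s2 (F : I -> E) :
  w (s1 ++ (\sum_(i <- r) F i) :: s2) = \sum_(i <- r) w (s1 ++ F i :: s2).
Proof.
apply: (big_morph (fun u => w (s1 ++ u :: s2))) => [u v|].
  exact: multilinearD.
exact: multilinear0.
Qed.

Context (w_alternating : forall s, ~~ uniq s -> w s = 0).

Lemma alternating_swap s1 s2 u v :
  w (s1 ++ u :: v :: s2) = - w (s1 ++ v :: u :: s2).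
Proof.
have w0 x : w (s1 ++ x :: x :: s2) = 0.
  by apply: w_alternating; rewrite cat_uniq /= inE eqxx /= !andbF.
(* Polarization: expand the vanishing value at [u + v], [u + v]. Moving the first vector into the
   prefix by [rcons] exposes the second slot to [multilinearD]. *)
have := w0 (u + v); rewrite multilinearD -!(cat_rcons _ _ (_ :: s2)).
rewrite !multilinearD !cat_rcons.
by rewrite !w0 add0r addr0 => /eqP; rewrite addr_eq0 => /eqP.
Qed.

(** Bringing [v] to the front crosses [s1] one vector at a time, from its last one, and each
    transposition costs a sign. *)
Lemma alternating_head s1 s2 v :
  w (s1 ++ v :: s2) = (-1) ^+ size s1 * w (v :: s1 ++ s2).
Proof.
elim/last_ind: s1 s2 => [|s1 u IH] s2; first by rewrite mul1r.
by rewrite !cat_rcons alternating_swap IH size_rcons exprS mulN1r mulNr.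
Qed.

End Multilinear.

(** * Interior product and Cartan's formula in charts *)

Section Cartan.
Context (R : realType) (n : nat) (M : manifold R n) (X : vector_field M).
Local Notation U c := (chart_dom (charts M c)).
Local Notation x_ c := (chart_map (charts M c)).
Local Notation p_ c := (chart_inv (charts M c)).
Implicit Types (w : preform M) (c : chart_index M).

Lemma chart_map_in c (x : M) : x \in U c -> x_ c x \in (x_ c @` U c)%classic.
Proof. by rewrite !inE => xU; exists x. Qed.

(** This turns a contraction with a vector that varies with the point into a finite sum of products
    of real functions, to which smoothness of products and the Leibniz rule apply. *)
Lemma form_head_sum p w c (x : M) u s : is_form p w ->
  w c x (u :: s) = \sum_(k < n) u 0 k * w c x ('e_k :: s).
Proof.
move=> fw; have lw := form_linear fw c x.
rewrite {1}[u]row_sum_delta (multilinear_sum lw _ [::]).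
by apply: eq_bigr => k _; rewrite (multilinearZ lw [::]).
Qed.

Lemma contraction_sum p w c s : is_form p w ->
  (fun y => w c (p_ c y) (X c (p_ c y) :: s)) =
  \sum_(k < n) (fun y => X c (p_ c y) 0 k) * (fun y => w c (p_ c y) ('e_k :: s)).
Proof.
by move=> fw; apply/funext => y; rewrite (form_head_sum _ _ _ _ fw) fct_sumE.
Qed.

Lemma interior_product_form p w : is_form p w ->
  is_form (p - 1) (interior_product X w).
Proof.
move=> fw; split.
- move=> c x s H; apply: (form_supp fw) => -[xU ps]; apply: H; split => //.
  by rewrite -ps /= -[(size s).+1]addn1 PoszD addrK.
- by move=> c x s1 s2 a u v; rewrite /interior_product -!cat_cons (form_linear fw).
- move=> c x s us; apply: (form_alternating fw) => /=.
  by rewrite negb_and us orbT.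
(* The components of [X] change by the same [jac] as the arguments, so the compatibility of [w]
   covers the whole list. *)
- move=> c c' x s xc xc'; rewrite /interior_product (form_compat fw _ xc xc') /=.
  by rewrite -(vcomp_compat X xc xc').
- move=> c s; have oU := @chart_image_open _ _ _ (charts M c).
  rewrite /interior_product (contraction_sum _ _ fw).
  apply: smooth_on_sum => // k; apply: smooth_onM => //.
    exact: (smooth_on_coord 0 k oU (@vcomp_smooth _ _ _ X c)).
  exact: (@form_smooth _ _ _ _ _ fw c ('e_k :: s)).
Qed.

(** Leibniz rule on the sum of the products [a k * b k]: differentiating [b k] gives the term with
    [X] frozen at [x], differentiating [a k] the term with the derivative of [X]. *)
Lemma chart_derive_contraction p w c (x : M) s v : is_form p w -> x \in U c ->
  chart_derive c (fun y => w c y (X c y :: s)) x v =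
  chart_derive c (fun y => w c y (X c x :: s)) x v
  + w c x (chart_derive c (X c) x v :: s).
Proof.
move=> fw xU; have xI := chart_map_in xU.
have xK : p_ c (x_ c x) = x by exact: chart_mapK.
pose a k y := X c (p_ c y) 0 k; pose b k y := w c (p_ c y) ('e_k :: s).
have dX : derivable (X c \o p_ c) (x_ c x) v.
  exact/diff_derivable/(@vcomp_smooth _ _ _ X c [::]).
have da k : derivable (a k) (x_ c x) v by move/derivable_mxP : dX; exact.
have db k : derivable (b k) (x_ c x) v.
  exact/diff_derivable/(form_smooth fw ('e_k :: s) [::]).
rewrite /chart_derive.
have -> : (fun y => w c y (X c y :: s)) \o p_ c = \sum_(k < n) a k * b k.
  exact: contraction_sum fw.
have -> : (fun y => w c y (X c x :: s)) \o p_ c = \sum_(k < n) X c x 0 k *: b k.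
  by apply/funext => y /=; rewrite (form_head_sum _ _ _ _ fw) fct_sumE.
rewrite !derive_sum => [|k|k]; [|exact: derivableZ|exact: derivableM].
rewrite (form_head_sum _ _ _ _ fw) -big_split; apply: eq_bigr => k _ /=.
rewrite deriveM // deriveZ // {1}/a {2}/b xK; congr (_ + _).
by rewrite -derive_coord // mulrC.
Qed.

(* In the chart, [i_X (d w)] differentiates [w] with the value of X frozen at
   the base point; the terms of [d (i_X w)] in which X itself is differentiated
   are those of the Lie derivative. *)
Lemma lie_cartan p w : is_form p w ->
  lie X w = ext_d (interior_product X w) + interior_product X (ext_d w).
Proof.
move=> fw; apply/funext => c; apply/funext => x; apply/funext => s.
rewrite -[RHS]/(ext_d (interior_product X w) c x s + ext_d w c x (X c x :: s)).
rewrite /lie /ext_d; case: ifPn => xU; last by rewrite addr0.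
(* The term of index 0 of [ext_d w] on [X c x :: s] is the derivative along [X]; the other indices
   are shifted by one, hence carry the opposite sign to those of [ext_d (interior_product X w)]. *)
rewrite big_ord_recl /= expr0 mul1r drop0 addrCA -big_split /=; congr (_ + _).
apply: eq_bigr => i _; set v := s`_i.
rewrite /interior_product (chart_derive_contraction _ _ fw) // mulrDr.
rewrite exprS mulN1r mulNr addrAC subrr add0r.
rewrite set_nthE ltn_ord (alternating_head (form_linear fw c x)) //.
  by rewrite size_take ltn_ord.
exact: form_alternating fw c x.
Qed.

Lemma formB p w1 w2 : is_form p w1 -> is_form p w2 -> is_form p (w1 - w2).
Proof.
have -> : w1 - w2 = (-1) *: w2 + w1 by rewrite scaleN1r addrC.
by move=> f1 f2; exact: (form_lin _ f2 f1).
Qed.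

Lemma ext_dB p w1 w2 : is_form p w1 -> is_form p w2 ->
  ext_d (w1 - w2) = ext_d w1 - ext_d w2.
Proof.
have -> : w1 - w2 = (-1) *: w2 + w1 by rewrite scaleN1r addrC.
by move=> f1 f2; rewrite (ext_d_lin _ f2 f1) scaleN1r addrC.
Qed.

Lemma interior_product_lin (a : R) w1 w2 :
  interior_product X (a *: w1 + w2) =
  a *: interior_product X w1 + interior_product X w2.
Proof. by []. Qed.

Lemma interior_productB w1 w2 :
  interior_product X (w1 - w2) = interior_product X w1 - interior_product X w2.
Proof. by []. Qed.

Lemma tilde_pairB a1 a2 b1 b2 :
  (a1, interior_product X a1 - b1) - (a2, interior_product X a2 - b2) =
  (a1 - a2, interior_product X (a1 - a2) - (b1 - b2)).
Proof.
congr pair => //.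
rewrite -[LHS]/((interior_product X a1 - b1) - (interior_product X a2 - b2)).
by rewrite interior_productB opprD [in RHS]opprD addrACA.
Qed.

(** In Cartan's expansion of [lie X a], the summand d i_X a cancels against the differential of the
    second entry. The result is the image of (da, db) under the backward map, which is therefore
    exact. *)
Lemma tilde_d_primitive p a b : is_form p a -> is_form (p - 1) b ->
  tilde_d X (a, interior_product X a + b) =
  (ext_d a, interior_product X (ext_d a) - ext_d b).
Proof.
move=> fa fb; have fi := interior_product_form fa.
rewrite /tilde_d [(_, _).1]/= [(_, _).2]/= (lie_cartan fa); congr pair.
(* Here [X] is a pattern variable standing for the contraction of [a]; the factor 1 gives the sum
   the shape that [ext_d_lin] expects. *)
rewrite -[X in ext_d (X + b)]scale1r (ext_d_lin _ fi fb) scale1r.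
by rewrite opprD [LHS]addrACA subrr add0r.
Qed.

End Cartan.

(** * Cocycle representatives and linear maps out of cohomology *)

Section Cohomology.
Context (R : realType) (C : complex R) (p : int).

Lemma cocycleP (w : ambient C) : cochains p w -> differential w = 0 ->
  w \in is_cocycle p.
Proof. by move=> cw dw; rewrite inE. Qed.

Lemma cocycle_cochain (z : cocycle C p) : cochains p (val z).
Proof. by have := valP z; rewrite inE => -[]. Qed.

Lemma cocycle_diff (z : cocycle C p) : differential (val z) = 0.
Proof. by have := valP z; rewrite inE => -[]. Qed.

Lemma cocycle_lin (a : R) (z1 z2 : cocycle C p) :
  val (a *: z1 + z2) = a *: val z1 + val z2.
Proof. exact: linearP. Qed.

Lemma coho_class_eqP (z1 z2 : cocycle C p) :
  (exists2 y, cochains (p - 1) y & differential y = val z1 - val z2) ->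
  coho_class z1 = coho_class z2.
Proof. by move=> H; apply/eqP; rewrite coho_class_eq inE. Qed.

Lemma coho_class_eq0 (z : cocycle C p) :
  (exists2 y, cochains (p - 1) y & differential y = val z) -> coho_class z = 0.
Proof.
move=> [y cy dy]; rewrite -[RHS](linear0 (@coho_class R C p)).
by apply: coho_class_eqP; exists y => //; rewrite dy [val 0]linear0 subr0.
Qed.

Lemma coho_class_repr_sub (z : cocycle C p) :
  exists2 y, cochains (p - 1) y &
    differential y = val z - val (repr (coho_class z)).
Proof.
have /eqP := coho_class_repr (coho_class z).
by rewrite coho_class_eq inE.
Qed.

(** Universal property of the quotient, realized by [F \o repr]: the chosen representative differs
    from [z] by a coboundary, which [F] kills. *)
Lemma coho_descend (V : lmodType R) (F : cocycle C p -> V) : linear F ->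
    (forall z y, cochains (p - 1) y -> differential y = val z -> F z = 0) ->
  exists G : {linear cohomology C p -> V}, forall z, G (coho_class z) = F z.
Proof.
move=> Flin F0.
have G_class z : F (repr (coho_class z)) = F z.
  have [y cy dy] := coho_class_repr_sub z.
  have Fr : F (z - repr (coho_class z)) = 0.
    by apply: (F0 _ y) => //; rewrite dy [RHS]linearB.
  rewrite -[in RHS](subrK (repr (coho_class z)) z) -[z - _]scale1r Flin.
  by rewrite Fr scaler0 add0r.
have Glin : linear (F \o repr : cohomology C p -> V).
  move=> a h1 h2; rewrite [h1]coho_class_repr [h2]coho_class_repr -linearP /=.
  by rewrite !G_class Flin.
pose gL := GRing.isLinear.Build R (cohomology C p) V _ (F \o repr) Glin.
pose G : {linear cohomology C p -> V} := HB.pack (F \o repr : cohomology C p -> V) gL.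
by exists G.
Qed.

Lemma coho_classW (h : cohomology C p) : exists z, h = coho_class z.
Proof. by exists (repr h); exact: coho_class_repr. Qed.

End Cohomology.

(** * Componentwise linear algebra for pairs of forms *)

Lemma linear_sub (R : pzRingType) (V : lmodType R) (k : R) (u1 u2 v1 v2 : V) :
  (k *: u1 + u2) - (k *: v1 + v2) = k *: (u1 - v1) + (u2 - v2).
Proof. by rewrite scalerBr opprD addrACA. Qed.

Section TildeAmbient.
Context (R : realType) (n : nat) (M : manifold R n) (X : vector_field M).
Implicit Types u v : ambient (tilde_complex X).

Lemma tilde_fst_lin (k : R) u v :
  (k *: u + v).1 = k *: u.1 + v.1 :> ambient (de_rham M).
Proof. exact: (@linearP _ _ _ _ (@fst (preform M) (preform M))). Qed.

Lemma tilde_snd_lin (k : R) u v :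
  (k *: u + v).2 = k *: u.2 + v.2 :> ambient (de_rham M).
Proof. exact: (@linearP _ _ _ _ (@snd (preform M) (preform M))). Qed.

End TildeAmbient.

(** * The mutually inverse maps on cohomology *)

Theorem mainTheorem1 (R : realType) (n : nat) (M : manifold R n)
    (X : vector_field M) (p : int) :
  exists (f : {linear cohomology (tilde_complex X) p ->
                 (cohomology (de_rham M) p * cohomology (de_rham M) (p - 1))%type})
         (g : {linear (cohomology (de_rham M) p * cohomology (de_rham M) (p - 1))%type
                 -> cohomology (tilde_complex X) p}),
    [/\ forall z : cocycle (tilde_complex X) p,
          exists (a : cocycle (de_rham M) p) (b : cocycle (de_rham M) (p - 1)),
            [/\ val a = (val z).1,
                val b = interior_product X (val z).1 - (val z).2 &
                f (coho_class z) = (coho_class a, coho_class b)],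
        forall (a : cocycle (de_rham M) p) (b : cocycle (de_rham M) (p - 1)),
          exists z : cocycle (tilde_complex X) p,
            val z = (val a, interior_product X (val a) - val b) /\
            g (coho_class a, coho_class b) = coho_class z,
        cancel f g & cancel g f].
Proof.
have a_in (z : cocycle (tilde_complex X) p) :
    (val z).1 \in @is_cocycle R (de_rham M) p.
  have [f1 _] := cocycle_cochain z; have [d1 _] := cocycle_diff z.
  exact: cocycleP.
have b_in (z : cocycle (tilde_complex X) p) :
    interior_product X (val z).1 - (val z).2 \in @is_cocycle R (de_rham M) (p - 1).
  have [f1 f2] := cocycle_cochain z; have [d1 d2] := cocycle_diff z.
  have fi := interior_product_form X f1.
  apply: cocycleP; first exact: (formB fi f2).
  rewrite /= (ext_dB fi f2).
  (* The second component of the cocycle equation is L_X phi = d psi, and L_X phi = d i_X phi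
     because phi is closed. *)
  by move: d2; rewrite (lie_cartan X f1) d1 addr0.
have z_in (a : cocycle (de_rham M) p) (b : cocycle (de_rham M) (p - 1)) :
    (val a, interior_product X (val a) - val b)
      \in @is_cocycle R (tilde_complex X) p.
  have fa := cocycle_cochain a; have fb := cocycle_cochain b.
  have da := cocycle_diff a; have db := cocycle_diff b.
  have fi := interior_product_form X fa.
  apply: cocycleP; first by split; [exact: fa|exact: (formB fi fb)].
  rewrite /= /tilde_d /= (ext_dB fi fb) (lie_cartan X fa).
  have -> : ext_d (val a) = 0 by exact: da.
  have -> : ext_d (val b) = 0 by exact: db.
  by rewrite subr0 addrAC subrr add0r.
pose A z := Cocycle (a_in z); pose B z := Cocycle (b_in z).
pose Z a b := Cocycle (z_in a b).
have AE z : val (A z) = (val z).1 by [].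
have BE z : val (B z) = interior_product X (val z).1 - (val z).2 by [].
have ZE a b : val (Z a b) = (val a, interior_product X (val a) - val b) by [].
have Alin : linear A.
  by move=> k z1 z2; apply: val_inj; rewrite cocycle_lin !AE cocycle_lin tilde_fst_lin.
have Blin : linear B.
  move=> k z1 z2; apply: val_inj; rewrite cocycle_lin !BE cocycle_lin.
  rewrite tilde_fst_lin tilde_snd_lin interior_product_lin.
  exact: linear_sub.
have [f fE] : exists f : {linear cohomology (tilde_complex X) p ->
    (cohomology (de_rham M) p * cohomology (de_rham M) (p - 1))%type},
    forall z, f (coho_class z) = (coho_class (A z), coho_class (B z)).
  apply: coho_descend => [k z1 z2|z y [f1 f2] dy].
    by rewrite Alin Blin !linearP.
  have dy1 : ext_d y.1 = (val z).1 by rewrite -dy.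
  have dy2 : lie X y.1 - ext_d y.2 = (val z).2 by rewrite -dy.
  have fi := interior_product_form X f1.
  congr pair; apply: coho_class_eq0; first by exists y.1.
  (* The second entry of the image is i_X d y.1 - (L_X y.1 - d y.2), which Cartan's formula reduces
     to d (y.2 - i_X y.1). *)
  exists (y.2 - interior_product X y.1); first exact: (formB f2 fi).
  rewrite /= (ext_dB f2 fi) -dy1 -dy2 (lie_cartan X f1).
  by rewrite [RHS]addrC opprB -addrA opprD addrNK.
have [g gE] : exists g : {linear
    (cohomology (de_rham M) p * cohomology (de_rham M) (p - 1))%type
      -> cohomology (tilde_complex X) p},
    forall a b, g (coho_class a, coho_class b) = coho_class (Z a b).
  have Zlin k a1 a2 b1 b2 :
      Z (k *: a1 + a2) (k *: b1 + b2) = k *: Z a1 b1 + Z a2 b2.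
    apply: val_inj; rewrite cocycle_lin !ZE !cocycle_lin interior_product_lin.
    rewrite [LHS]surjective_pairing [RHS]surjective_pairing.
    congr pair; rewrite ?tilde_fst_lin ?tilde_snd_lin //.
    exact: linear_sub.
  (* The source is a product of two quotients, so representatives are chosen in each factor and
     independence of both choices is checked at once in [GE]. *)
  pose G (h : cohomology (de_rham M) p * cohomology (de_rham M) (p - 1)) :=
    coho_class (Z (repr h.1) (repr h.2)).
  have GE a b : G (coho_class a, coho_class b) = coho_class (Z a b).
    have [alpha fa da] := coho_class_repr_sub a.
    have [beta fb db] := coho_class_repr_sub b.
    rewrite /G /=; apply/esym/coho_class_eqP.
    have fi := interior_product_form X fa.
    exists (alpha, interior_product X alpha + beta).
      split; first exact: fa.
      by rewrite -[interior_product X alpha]scale1r; exact: (form_lin _ fi fb).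
    rewrite [LHS](tilde_d_primitive X fa fb) !ZE.
    have -> : ext_d alpha = val a - val (repr (coho_class a)) := da.
    have -> : ext_d beta = val b - val (repr (coho_class b)) := db.
    exact/esym/tilde_pairB.
  have Glin : linear G.
    move=> k [h1 h2] [h1' h2'].
    have [a ->] := coho_classW h1; have [b ->] := coho_classW h2.
    have [a' ->] := coho_classW h1'; have [b' ->] := coho_classW h2'.
    have -> : k *: (coho_class a, coho_class b) + (coho_class a', coho_class b') =
        (coho_class (k *: a + a'), coho_class (k *: b + b')) by rewrite !linearP.
    by rewrite !GE Zlin linearP.
  pose gL := GRing.isLinear.Build R _ _ _ G Glin.
  pose g : {linear (cohomology (de_rham M) p * cohomology (de_rham M) (p - 1))%type
      -> cohomology (tilde_complex X) p} := HB.pack G gL.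
  by exists g.
exists f, g; split.
- by move=> z; exists (A z), (B z).
- by move=> a b; exists (Z a b).
(* Both maps keep the first entry and subtract the second from its contraction, so the composite is
   already the identity on cocycles. *)
- move=> h; have [z ->] := coho_classW h; rewrite fE gE; congr coho_class.
  by apply: val_inj => /=; rewrite subKr -surjective_pairing.
- move=> [h1 h2]; have [a ->] := coho_classW h1; have [b ->] := coho_classW h2.
  rewrite gE fE; congr (coho_class _, coho_class _); apply: val_inj => //=.
  by rewrite subKr.
Qed.
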